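(* For every mutually completely dependent copula $A_h$ the surface area and Kendall's $\tau$ satisfy $$\mathrm{surf}(A_h)= \sqrt{2} - \frac{2\sqrt{2} - 1 - \sqrt{3}}{4}\,\bigl(1-\tau(A_h)\bigr).$$
   Context: $\lambda$ and $\lambda_2$ denote Lebesgue measure on the Borel sets of $[0,1]$ and $[0,1]^2$. For a bivariate copula $A$, $\mu_A$ denotes the corresponding doubly stochastic probability measure on $[0,1]^2$, i.e. $\mu_A([0,x]\times[0,y])=A(x,y)$ for all $x,y\in[0,1]$. Mutually completely dependent copulas: for a (Borel measurable) transformation $h:[0,1]\to[0,1]$ that is $\lambda$-preserving (i.e. $\lambda(h^{-1}(E))=\lambda(E)$ for every Borel set $E\subseteq[0,1]$), the completely dependent copula $A_h$ is the copula for which $K(x,E)=\mathbf 1_E(h(x))$ is a version of the regular conditional distribution of $Y$ given $X=x$ when $(X,Y)\sim A_h$; equivalently $A_h(x,y)=\lambda\{t\in[0,x]: h(t)\le y\}$. $A_h$ is called mutually completely dependent if $h$ is moreover bijective. Kendall's tau of a copula $A$ is $\tau(A)=4\int_{[0,1]^2}A\,d\mu_A-1$. The surface area of a copula $A$ (copulas are Lipschitz, so the partial derivatives exist $\lambda_2$-almost everywhere) is $$\mathrm{surf}(A)=\int_{[0,1]^2}\sqrt{\left(\tfrac{\partial A}{\partial x}(x,y)\right)^2+\left(\tfrac{\partial A}{\partial y}(x,y)\right)^2+1}\;d\lambda_2(x,y).$$ *)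

(* Defs.v *)
From mathcomp Require Import all_boot all_order all_algebra.
From mathcomp Require Import all_classical all_reals all_analysis.

Set Implicit Arguments.
Unset Strict Implicit.
Unset Printing Implicit Defensive.

Import Order.TTheory GRing.Theory Num.Theory.
Import numFieldNormedType.Exports.

Local Open Scope classical_set_scope.
Local Open Scope ring_scope.

(* Bivariate copulas are represented by functions R -> R -> R, of which only
   the values on [0, 1] x [0, 1] are meaningful.  Transformations of [0, 1]
   are likewise represented by functions R -> R. *)

Definition unit_itv (R : realType) : set R := `[0, 1].
Arguments unit_itv : clear implicits.

Definition lambda_preserving (R : realType) (h : R -> R) : Prop :=
  [/\ set_fun (unit_itv R) (unit_itv R) h,
      measurable_fun (unit_itv R) h
    & forall E : set R, measurable E -> E `<=` unit_itv R ->
        lebesgue_measure (unit_itv R `&` h @^-1` E) = lebesgue_measure E].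

(* For x in [0, 1] the set below is {t in [0, x] | h t <= y}.  Writing it as a
   subset of [0, 1] makes cd_copula h, on the whole plane, the joint
   distribution function of (X, h X) with X uniform on [0, 1]; it is therefore
   Lipschitz across the boundary of the unit square. *)
Definition cd_copula (R : realType) (h : R -> R) (x y : R) : R :=
  fine (lebesgue_measure [set t : R | unit_itv R t /\ t <= x /\ h t <= y]).

Definition mutually_completely_dependent (R : realType) (h : R -> R) : Prop :=
  lambda_preserving h /\ set_bij (unit_itv R) (unit_itv R) h.

(* The measure lives on the whole plane; when A is a copula it is concentrated
   on the unit square since A 1 1 = 1. *)
Definition is_copula_measure (R : realType) (A : R -> R -> R)
    (mu : probability (measurableTypeR R * measurableTypeR R)%type R) : Prop :=
  forall x y : R, 0 <= x <= 1 -> 0 <= y <= 1 ->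
    mu (`[0, x] `*` `[0, y]) = (A x y)%:E.

(* A copula has exactly one such measure; [get] selects it. *)
Definition copula_measure (R : realType) (A : R -> R -> R) :
    probability (measurableTypeR R * measurableTypeR R)%type R :=
  get [set mu | is_copula_measure A mu].

Definition kendall_tau (R : realType) (A : R -> R -> R) : R :=
  4 * Rintegral (copula_measure A) (unit_itv R `*` unit_itv R)
        (fun z => A z.1 z.2) - 1.

Definition lebesgue2 (R : realType) :
    set (measurableTypeR R * measurableTypeR R) -> \bar R :=
  (lebesgue_measure \x lebesgue_measure)%E.

Definition partial_x (R : realType) (A : R -> R -> R) (x y : R) : R :=
  derive1 (fun t : R => A t y) x.

Definition partial_y (R : realType) (A : R -> R -> R) (x y : R) : R :=
  derive1 (fun t : R => A x t) y.

Definition surf (R : realType) (A : R -> R -> R) : \bar R :=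
  (\int[@lebesgue2 R]_(z in unit_itv R `*` unit_itv R)
     (Num.sqrt (partial_x A z.1 z.2 ^+ 2 + partial_y A z.1 z.2 ^+ 2 + 1))%:E)%E.

(* Main.v *)
Require Import Defs.
From mathcomp Require Import all_boot all_order all_algebra.
From mathcomp Require Import all_classical all_reals all_analysis.
From mathcomp Require Import measurable_realfun.
From mathcomp Require Import ring lra.

(* Let I = [0, 1].  Almost everywhere dA/dx is the indicator of
   U = {x in I, h x <= y}, by Lebesgue's differentiation theorem on horizontal
   lines.  As h is injective it has an a.e. inverse g which is Borel and
   satisfies A_h(x, y) = A_g(y, x), so dA/dy is a.e. the indicator of
   V = {y in I, g y <= x}.  Hence
     surf A = 1 + (sqrt 2 - 1) (|U| + |V|) + (sqrt 3 - 2 sqrt 2 + 1) |U `&` V|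
   where |U| = |V| = 1/2, and slicing U `&` V vertically gives
   |U `&` V| = \int_I (x - A(x, h x)) dx = 1/2 - (tau A + 1) / 4. *)

Import Order.TTheory GRing.Theory Num.Theory.
Import numFieldNormedType.Exports.

Local Open Scope classical_set_scope.
Local Open Scope ring_scope.

Local Notation plane R := (measurableTypeR R * measurableTypeR R)%type.

(** * Null sets in measures and integrals *)

Lemma invSn_lt {R : realType} (e : R) : 0 < e -> exists n : nat, n.+1%:R^-1 < e.
Proof.
by move=> e0; exists (Num.truncn e^-1); rewrite invf_plt ?posrE// truncnS_gt.
Qed.

Section off_null_sets.
Context {d : measure_display} {T : measurableType d} {R : realType}.
Variable mu : {measure set T -> \bar R}.

Lemma eq_measure_off_null (A B N : set T) :
  measurable A -> measurable B -> measurable N -> mu N = 0%E ->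
  A `\` N = B `\` N -> mu A = mu B.
Proof.
move=> mA mB mN N0 AB.
have H (C : set T) : measurable C -> mu C = mu (C `\` N).
  move=> mC; rewrite -(@measureU0 _ _ _ mu (C `\` N) (C `&` N)).
  - by rewrite setUC setUIDK.
  - exact: measurableD.
  - exact: measurableI.
  - by apply: (@subset_measure0 _ _ _ mu _ N) => //; exact: measurableI.
by rewrite (H A mA) AB -H.
Qed.

Import HBNNSimple.

(* [f] need not be measurable: the integral of a nonnegative function is a
   supremum over the simple functions below it. *)
Lemma ge0_integral_off_null (D N : set T) (f g : T -> \bar R) :
  measurable D -> measurable N -> mu N = 0%E -> measurable_fun D g ->
  (forall x, D x -> (0 <= f x)%E) -> (forall x, D x -> (0 <= g x)%E) ->
  (forall x, D x -> ~ N x -> f x = g x) ->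
  (\int[mu]_(x in D) f x = \int[mu]_(x in D) g x)%E.
Proof.
move=> mD mN N0 mg f0 g0 fg.
rewrite integral_mkcond [RHS]integral_mkcond.
have {}mg : measurable_fun setT (g \_ D) by apply/(measurable_restrictT g mD).
have {}f0 x : (0 <= (f \_ D) x)%E.
  by rewrite patchE; case: ifPn => // /set_mem /f0.
have {}g0 x : (0 <= (g \_ D) x)%E.
  by rewrite patchE; case: ifPn => // /set_mem /g0.
have {fg} : forall x, ~ N x -> (f \_ D) x = (g \_ D) x.
  by move=> x Nx; rewrite !patchE; case: ifPn => // /set_mem /fg; exact.
move: (f \_ D) (g \_ D) mg f0 g0 => {f g mD D} f g mg f0 g0 fg.
(* For the upper bound, a simple function below [f] lies below [g] off [N], and both of these are
   measurable. *)
apply/eqP; rewrite eq_le; apply/andP; split.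
  rewrite ge0_integralTE//; apply: ge_ereal_sup => _ [s /= sf <-].
  have -> : sintegral mu s = (\int[mu]_x (s x)%:E)%E.
    by rewrite integral_nnsfun// patch_setT.
  apply: ae_ge0_le_integral => //.
  - by move=> x _; rewrite lee_fin.
  - exact/measurable_EFinP.
  - exists N; split => // x /= H; apply: contrapT => Nx; apply: H => _.
    by rewrite -fg.
have mCN : measurable (~` N) by exact: measurableC.
(* For the lower bound, [g] may be set to 0 on [N]; a simple function below the result then lies
   below [f] everywhere, because [f] is nonnegative on [N]. *)
have -> : (\int[mu]_x g x = \int[mu]_x (g \_ (~` N)) x)%E.
  apply: ge0_ae_eq_integral => //.
  - by apply/(measurable_restrictT g mCN); exact: measurable_funS mg.
  - by move=> x _; rewrite patchE; case: ifPn.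
  - exists N; split => // x /= H; apply: contrapT => Nx; apply: H => _.
    by rewrite patchE mem_set.
have gN0 x : (0 <= (g \_ (~` N)) x)%E by rewrite patchE; case: ifPn.
rewrite !ge0_integralTE//; apply: le_ereal_sup => _ [s /= sg <-].
exists s => //= x; apply: (le_trans (sg x)).
by rewrite patchE; case: ifPn => // /set_mem Nx; rewrite fg.
Qed.

End off_null_sets.

(** * Almost everywhere Borel inverse of an injection *)

(* Lusin's theorem exhausts [A] up to a null set by countably many compact sets
   on which [h] is continuous; as [h] is injective, its inverse is Borel on the
   union of their images. *)
Lemma measurable_inverse_off_null {R : realType} (A : set R) (h : R -> R) :
  measurable A -> (lebesgue_measure A < +oo)%E ->
  measurable_fun A h -> set_inj A h ->
  exists g : R -> R, exists B : set R,
    [/\ measurable_fun setT g, measurable B, B `<=` A,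
        lebesgue_measure (A `\` B) = 0%E
      & forall t, B t -> g (h t) = t].
Proof.
move=> mA Afin mh hinj.
have /choice [K HK] : forall n : nat, exists K : set R, [/\ compact K, K `<=` A,
    (lebesgue_measure (A `\` K) < (n.+1%:R^-1)%:E)%E
    & {within K, continuous h}].
  by move=> n; apply: measurable_almost_continuous => //; rewrite invr_gt0.
have mcompact (C : set R) : compact C -> measurable C.
  by move=> cC; apply: closed_measurable; apply: compact_closed => //.
have mK n : measurable (K n) by case: (HK n) => /mcompact.
pose B := \bigcup_n K n.
have mB : measurable B by exact: bigcupT_measurable.
have BA : B `<=` A by move=> t [n _]; case: (HK n) => _ + _ _; exact.
have mimage n (C : set R) : closed C -> measurable (h @` (K n `&` C)).
  move=> cC; apply: mcompact; apply: continuous_compact.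
    by case: (HK n) => _ _ _; apply: continuous_subspaceW; exact: subIsetl.
  by apply: compact_closedI => //; case: (HK n).
pose g y := if pselect ((h @` B) y) is left e
            then projT1 (cid2 e) else 0.
have gh t : B t -> g (h t) = t.
  move=> Bt; rewrite /g; case: pselect => [e|]; last by case; exists t.
  case: (cid2 e) => s /= Bs /hinj; apply; apply/mem_set; exact: BA.
have gB y : ~ (h @` B) y -> g y = 0 by rewrite /g; case: pselect.
exists g, B; split => //.
- move=> _; apply: (measurability _ (RGenCInfty.measurableE R)) => //.
  move=> _ [_ [x -> <-]]; rewrite setTI.
  (* Off the image of [B] the function [g] takes the default value 0, so the complement of that
     image belongs to the preimage exactly when [x <= 0]. *)
  have -> : g @^-1` `[x, +oo[ = \bigcup_n (h @` (K n `&` `[x, +oo[)) `|`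
      (if x <= 0 then ~` (\bigcup_n (h @` K n)) else set0).
    apply/seteqP; split=> y /=.
      have [[t [n _ Knt] <-]|yB] := pselect ((h @` B) y).
        by rewrite gh; [left; exists n => //; exists t|exists n].
      rewrite gB// in_itv/= andbT => x0; right; rewrite x0 => -[n _ [t Knt ty]].
      by apply: yB; exists t => //; exists n.
    case=> [[n _ [t [Knt xt] <-]]|]; first by rewrite gh//; exists n.
    case: ifP => // x0 yB; rewrite gB ?in_itv/= ?x0// => -[t [n _ Knt] ty].
    by apply: yB; exists n => //; exists t.
  apply: measurableU.
    by apply: bigcupT_measurable => n; apply: mimage; exact: interval_closed.
  case: ifP => // _; apply: measurableC; apply: bigcupT_measurable => n.
  by rewrite -[K n]setIT; apply: mimage; exact: closedT.
- - apply/eqP; rewrite eq_le measure_ge0 andbT.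
  (* The set missed by [B] is contained in the set missed by each single [K n], whose measure is
     below [n.+1%:R^-1]. *)
  apply/lee_addgt0Pr => e e0; rewrite add0e.
  have [n ne] := invSn_lt e e0.
  case: (HK n) => _ _ /ltW Kn _.
  apply: le_trans (le_trans Kn _); last by rewrite lee_fin ltW.
  apply: le_measure; first by rewrite inE; exact: (measurableD mA mB).
    by rewrite inE; exact: (measurableD mA (mK n)).
  by move=> t [At Bt]; split => // Kt; apply: Bt; exists n.
Qed.

(** * Copulas of completely dependent pairs: measurability, continuity, transposition *)

(** The set where dA/dx is 1. Only the first coordinate is confined to the unit interval, in
    accordance with [cd_copula] being defined on the whole plane; areas are taken after intersection
    with the unit square. *)
Definition cd_region {R : realType} (f : R -> R) : set (plane R) :=
  [set z | unit_itv R z.1 /\ f z.1 <= z.2].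

(** The mirror image of [cd_region g] in the diagonal; for an almost everywhere inverse [g] this is
    where dA/dy is 1. *)
Definition cd_region_swap {R : realType} (g : R -> R) : set (plane R) :=
  [set z | unit_itv R z.2 /\ g z.2 <= z.1].

Section cd_copula_theory.
Context {R : realType}.
Implicit Types f g : R -> R.
Local Notation I := (unit_itv R).
Local Notation leb := (@lebesgue_measure R).

Lemma measurable_unit_itv : measurable (I : set (measurableTypeR R)).
Proof. exact: measurable_itv. Qed.

Lemma lebesgue_unit_itv : leb I = 1%E.
Proof. by rewrite lebesgue_measure_itv/= lte_fin ltr01 oppr0 adde0. Qed.

Lemma measurable_le_set {d} {T : measurableType d} (u v : T -> R) :
  measurable_fun setT u -> measurable_fun setT v ->
  measurable [set t | u t <= v t].
Proof.
by move=> mu mv; rewrite -[X in measurable X]setTI; exact: measurable_fun_le.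
Qed.

Lemma measurable_cd_region f :
  measurable_fun setT f -> measurable (cd_region f).
Proof.
move=> mf; apply: measurableI.
  rewrite -[X in measurable X]setTI; apply: measurable_fst => //.
  exact: measurable_unit_itv.
apply: measurable_le_set; last exact: measurable_snd.
by apply: measurableT_comp => //; exact: measurable_fst.
Qed.

Lemma measurable_cd_region_swap g :
  measurable_fun setT g -> measurable (cd_region_swap g).
Proof.
move=> mg; apply: measurableI.
  rewrite -[X in measurable X]setTI; apply: measurable_snd => //.
  exact: measurable_unit_itv.
apply: measurable_le_set; last exact: measurable_fst.
by apply: measurableT_comp => //; exact: measurable_snd.
Qed.

Lemma measurable_cd_set f (x y : R) : measurable_fun setT f ->
  measurable [set t : measurableTypeR R | I t /\ t <= x /\ f t <= y].
Proof.
move=> mf; apply: measurableI; first exact: measurable_unit_itv.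
by apply: measurableI; exact: measurable_le_set.
Qed.

Lemma cd_set_fin f (x y : R) : measurable_fun setT f ->
  (leb [set t : R | I t /\ (t <= x)%R /\ (f t <= y)%R] < +oo)%E.
Proof.
move=> mf; apply: (@le_lt_trans _ _ (leb I)); last first.
  by rewrite lebesgue_unit_itv ltry.
apply: le_measure; rewrite ?inE; last by move=> t [].
  exact: measurable_cd_set.
exact: measurable_unit_itv.
Qed.

Lemma cd_copulaE f (x y : R) : measurable_fun setT f ->
  (cd_copula f x y)%:E = leb [set t : R | I t /\ t <= x /\ f t <= y].
Proof.
by move=> mf; rewrite /cd_copula fineK// ge0_fin_numE ?measure_ge0// cd_set_fin.
Qed.

(** Raising the bound from [x'] to [x] adds to the defining set only points of []x', x]]. The
    resulting continuity is what allows difference quotients to be tested on rational increments. *)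
Lemma cd_copula_lip f (x x' y : R) : measurable_fun setT f ->
  `|cd_copula f x y - cd_copula f x' y| <= `|x - x'|.
Proof.
move=> mf; wlog xx' : x x' / x' <= x.
  move=> H; have [|/ltW] := leP x' x; first exact: H.
  by move=> /H; rewrite distrC [X in _ <= X]distrC.
have le1 : cd_copula f x' y <= cd_copula f x y.
  rewrite -lee_fin !cd_copulaE//; apply: le_measure; rewrite ?inE.
  - exact: measurable_cd_set.
  - exact: measurable_cd_set.
  - by move=> t [It [tx fy]]; split => //; split => //; exact: le_trans xx'.
rewrite !ger0_norm ?subr_ge0//.
rewrite lerBlDr -lee_fin EFinD !cd_copulaE//.
have <- : leb `]x', x] = (x - x')%:E.
  rewrite lebesgue_measure_itv/= lte_fin.
  by case: ltgtP xx' => //= ->; rewrite subrr.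
apply: le_trans (measureU2 _ _ _) => //; last exact: measurable_cd_set.
apply: le_measure; rewrite ?inE.
- exact: measurable_cd_set.
- by apply: measurableU => //; exact: measurable_cd_set.
- move=> t [It [tx fy]]; have [tx'|tx'] := leP t x'; [by right|left].
  by rewrite /= in_itv/= tx' tx.
Qed.

(** The value at [(x, y)] is the measure of the section at [(x, y)] of one measurable subset [S] of
    plane times line, and such section measures are measurable in the base point. *)
Lemma measurable_cd_copula f : measurable_fun setT f ->
  measurable_fun (setT : set (plane R)) (fun z => cd_copula f z.1 z.2).
Proof.
move=> mf.
pose S : set (plane R * measurableTypeR R) :=
  [set u | I u.2 /\ u.2 <= u.1.1 /\ f u.2 <= u.1.2].
have mS : measurable S.
  apply: measurableI.
    rewrite -[X in measurable X]setTI; apply: measurable_snd => //.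
    exact: measurable_unit_itv.
  apply: measurableI; apply: measurable_le_set => //.
  - exact: measurableT_comp.
  - exact: measurableT_comp.
  - exact: measurableT_comp.
have := measurable_fun_xsection leb mS.
move=> /(measurableT_comp (@fine_measurable R setT measurableT)).
apply: eq_measurable_fun => z _ /=; rewrite /cd_copula; congr (fine (leb _)).
by apply/seteqP; split => t; rewrite /xsection/= inE.
Qed.

End cd_copula_theory.

(** The defining set only sees points of the unit interval. A map measurable there can thus be
    traded for one measurable on the whole line. *)
Lemma cd_copula_restrict {R : realType} (h : R -> R) :
  cd_copula (h \_ (unit_itv R)) = cd_copula h.
Proof.
apply/funext => x; apply/funext => y; rewrite /cd_copula; congr (fine (_ _)).
by apply/seteqP; split=> t /= [It]; rewrite patchE mem_set.
Qed.

(** The preimage under [h] of the set defining [cd_copula g y x] is given by [h t <= y] and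
    [g (h t) <= x]; on [B] the latter reads [t <= x]. Since [h] preserves Lebesgue measure, both
    sets have the same measure. *)
Lemma cd_copula_swap {R : realType} (h g : R -> R) (B : set R) (x y : R) :
  lambda_preserving h -> measurable_fun setT g ->
  measurable B -> lebesgue_measure (unit_itv R `\` B) = 0%E ->
  (forall t, B t -> g (h t) = t) ->
  cd_copula g y x = cd_copula h x y.
Proof.
move=> [hI mh hpres] mg mB B0 gh; rewrite -(cd_copula_restrict h).
have mI := @measurable_unit_itv R.
have mh' : measurable_fun setT (h \_ (unit_itv R)).
  exact/(measurable_restrictT h mI).
apply: EFin_inj; rewrite !cd_copulaE//.
rewrite -hpres; [|exact: measurable_cd_set|by move=> t []].
apply: (@eq_measure_off_null _ _ _ lebesgue_measure _ _ (unit_itv R `\` B)) => //.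
- by apply: mh => //; exact: measurable_cd_set.
- exact: measurable_cd_set.
- exact: measurableD.
apply/seteqP; split => t /=; rewrite patchE.
  move=> [[It [_ [hy gx]]] nB]; rewrite mem_set//; split => //; split => //.
  by move: gx; rewrite gh//; apply: contrapT => nBt; apply: nB.
move=> [[It [tx]]]; rewrite mem_set// => hy nB; split => //; split => //.
split; first exact: hI.
by rewrite gh//; apply: contrapT => nBt; apply: nB.
Qed.

(** * Partial derivatives almost everywhere *)

Section rational_difference_quotients.
Context {R : realType}.

(* Restricting to rational increments makes the set of points where the
   derivative takes a prescribed value measurable in the plane. *)
Definition rat_quotient_cvg (F : R -> R) (x L : R) : Prop :=
  forall n : nat, exists m : nat, forall q : rat,
    0 < `|ratr q : R| < m.+1%:R^-1 ->
    `|(ratr q)^-1 * (F (ratr q + x) - F x) - L| <= n.+1%:R^-1.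

Lemma derivable_rat_quotient_cvg (F : R -> R) (x L : R) :
  derivable F x 1 -> derive1 F x = L -> rat_quotient_cvg F x L.
Proof.
move=> dF <- n.
have : h^-1 *: (F (h + x) - F x) @[h --> 0^'] --> derive1 F x.
  apply/cvg_ex; move: dF => /cvg_ex[l Hl]; exists l.
  by move: Hl => /=; under eq_fun do rewrite scaler1.
have n0 : 0 < n.+1%:R^-1 :> R by rewrite invr_gt0.
move=> /cvgrPdist_le /(_ _ n0); rewrite near_withinE => -[e /= e0 He].
have [m me] := invSn_lt e e0; exists m => q /andP[q0 qm].
rewrite distrC; apply: (He (ratr q)) => /=.
  by rewrite sub0r normrN (lt_trans qm).
by rewrite -normr_gt0.
Qed.

(** If the quotient missed the tolerance at a small real increment [h], by continuity it would do so
    on a neighbourhood of [h], hence at a rational increment that is still nonzero and small. *)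
Lemma rat_quotient_cvg_derive1 (F : R -> R) (x L : R) :
  continuous F -> rat_quotient_cvg F x L -> derive1 F x = L.
Proof.
move=> cF FL; apply/cvg_lim => //; apply/cvgrPdist_le => e e0.
have [n ne] := invSn_lt e e0; have [m Hm] := FL n.
have m0 : 0 < m.+1%:R^-1 :> R by rewrite invr_gt0.
rewrite near_withinE; exists m.+1%:R^-1 => //= h /=.
rewrite sub0r normrN => hm h0; rewrite distrC; apply: le_trans (ltW ne).
rewrite leNgt; apply/negP => Hh.
pose Q (r : R) : R := r^-1 * (F (r + x) - F x) - L.
have cQ : {for h, continuous Q}.
  apply: cvgB; last exact: cvg_cst.
  apply: cvgM; first exact: cvgV.
  apply: cvgB; last exact: cvg_cst.
  apply: (@cvg_comp _ _ _ (fun r => r + x) F); last exact: cF.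
  by apply: cvgD; [exact: cvg_id|exact: cvg_cst].
have Qnear : \forall r \near h, n.+1%:R^-1 < `|Q r|.
  have cQn : `|Q r| @[r --> h] --> `|Q h| by exact: cvg_norm.
  exact: (cvgr_gt _ cQn).
have cn : `|r| @[r --> h] --> `|h| by apply: cvg_norm; exact: cvg_id.
have hgt : \forall r \near h, 0 < `|r|.
  by apply: (cvgr_gt _ cn); rewrite normr_gt0.
have hlt : \forall r \near h, `|r| < m.+1%:R^-1 by exact: (cvgr_lt _ cn).
have : \forall r \near h, [/\ n.+1%:R^-1 < `|Q r|, 0 < `|r| & `|r| < m.+1%:R^-1].
  by near do split.
rewrite /prop_near1 nbhsE => -[U [oU Uh] HU].
have [r [/HU[Qr r0 rm] [q _ qr]]] : U `&` range ratr !=set0.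
  by apply: dense_rat => //; exists h.
have /Hm : 0 < `|ratr q : R| < m.+1%:R^-1 by rewrite qr r0.
by rewrite leNgt qr Qr.
Unshelve. all: by end_near. Qed.

End rational_difference_quotients.

(** For fixed [y] the copula is the primitive from -oo of the indicator of [D], so the Lebesgue form
    of the fundamental theorem of calculus applies. *)
Lemma ae_derive1_cd_copula {R : realType} (f : R -> R) (y : R) :
  measurable_fun setT f ->
  {ae @lebesgue_measure R, forall x,
    derivable (fun t => cd_copula f t y) x 1 /\
    derive1 (fun t => cd_copula f t y) x = \1_(cd_region f) (x, y)}.
Proof.
move=> mf; pose D : set R := [set t | unit_itv R t /\ f t <= y].
have mD : measurable D.
  by apply: measurableI; [exact: measurable_unit_itv|exact: measurable_le_set].
have Dfin : (@lebesgue_measure R D < +oo)%E.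
  apply: (@le_lt_trans _ _ (lebesgue_measure (unit_itv R))).
    by apply: le_measure; rewrite ?inE//; [exact: measurable_unit_itv|move=> t []].
  by rewrite lebesgue_unit_itv ltry.
have intD x : lebesgue_measure.-integrable `]-oo, x] (EFin \o (\1_D : R -> R)).
  apply: (@integrableS _ _ _ _ setT) => //.
  apply/integrableP; split; first by apply/measurable_EFinP.
  under eq_integral do rewrite /= ger0_norm//.
  by rewrite integral_indic// setIT.
have := FTC1Ny intD (locally_integrable_indic openT mD).
suff -> : (fun x => \int[lebesgue_measure]_(t in `]-oo, x]) \1_D t) =
    (fun t => cd_copula f t y).
  apply: filterS; first exact: (ae_filter_ringOfSetsType lebesgue_measure).
  by move=> x [dF ->]; split.
apply/funext => x; rewrite /Rintegral integral_indic// /cd_copula.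
congr (fine (_ _)); apply/seteqP; split => t /=.
  by rewrite in_itv/= => -[[]].
by rewrite in_itv/= => -[? []].
Qed.

(** The points where the rational quotients have the right limit are cut out by countably many
    measurable conditions. Their complement [N] is therefore measurable in the plane, so that null
    horizontal sections make it a planar null set. *)
Lemma partial_x_cd_copula {R : realType} (f : R -> R) : measurable_fun setT f ->
  exists N : set (plane R), [/\ measurable N,
    forall y, @lebesgue_measure R (ysection N y) = 0%E
    & forall x y, ~ N (x, y) ->
      partial_x (cd_copula f) x y = \1_(cd_region f) (x, y)].
Proof.
move=> mf.
(* An enumeration of the rationals; codes that decode to nothing yield the increment 0, for which
   the condition in [E] is vacuous. *)
pose r (k : nat) : rat := odflt 0 (unpickle k).
pose E n m k : set (plane R) := [set z |
  0 < `|ratr (r k) : R| < m.+1%:R^-1 ->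
  `|(ratr (r k))^-1 * (cd_copula f (ratr (r k) + z.1) z.2 - cd_copula f z.1 z.2)
    - \1_(cd_region f) z| <= n.+1%:R^-1].
have EP x y : (\bigcap_n \bigcup_m \bigcap_k E n m k) (x, y) <->
    rat_quotient_cvg (fun t => cd_copula f t y) x (\1_(cd_region f) (x, y)).
  split=> H n.
    have [m _ Hm] := H n I; exists m => q q0.
    have := Hm (pickle q) I; rewrite /E /= /r pickleK/=; exact.
  move=> _; have [m Hm] := H n; exists m => // k _; exact: Hm.
have mE n m k : measurable (E n m k).
  have [c|/negP c] := boolP (0 < `|ratr (r k) : R| < m.+1%:R^-1); last first.
    by rewrite (_ : E n m k = setT)//; apply/seteqP; split => // z _; rewrite /E /= => /c.
  rewrite (_ : E n m k = [set z |
      `|(ratr (r k))^-1 * (cd_copula f (ratr (r k) + z.1) z.2 - cd_copula f z.1 z.2)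
      - \1_(cd_region f) z| <= n.+1%:R^-1]); last first.
    by apply/seteqP; split => z /= H; [exact: H|].
  apply: measurable_le_set => //; apply: measurableT_comp => //.
  apply: measurable_funB; last first.
    by apply: measurable_indic; exact: measurable_cd_region.
  apply: measurable_funM => //; apply: measurable_funB.
    apply: (@measurableT_comp _ _ _ _ _ _ (fun z : plane R => cd_copula f z.1 z.2)
      _ (fun z : plane R => (ratr (r k) + z.1, z.2) : plane R)).
      exact: measurable_cd_copula.
    apply: measurable_fun_pair; last exact: measurable_snd.
    by apply: measurable_funD => //; exact: measurable_fst.
  exact: measurable_cd_copula.
have mEE : measurable (\bigcap_n \bigcup_m \bigcap_k E n m k).
  apply: bigcapT_measurable => n; apply: bigcupT_measurable => m.
  exact: bigcapT_measurable.
exists (~` (\bigcap_n \bigcup_m \bigcap_k E n m k)); split.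
- exact: measurableC.
- move=> y; have [N [mN N0 HN]] := ae_derive1_cd_copula f y mf.
  apply: (@subset_measure0 _ _ _ _ _ N) => //.
    by apply: measurable_ysection; exact: measurableC.
  move=> x; rewrite /ysection/= inE => nE; apply: HN => /= -[dF dFE].
  by apply: nE; apply/EP; exact: derivable_rat_quotient_cvg.
move=> x y /contrapT /EP; apply: rat_quotient_cvg_derive1.
move=> t; apply/cvgrPdist_le => e e0; near=> s.
apply: le_trans (cd_copula_lip f t s y mf) _.
by near: s; apply: cvgr_dist_le.
Unshelve. all: by end_near. Qed.

(** * Uniqueness of the measure of a copula *)

Section copula_measures.
Context {R : realType}.
Local Notation I := (unit_itv R).
Local Notation leb := (@lebesgue_measure R).

(** A half-plane where one coordinate exceeds [x] is the complement of a countable union of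
    quadrants, so both projections are measurable for the sigma-algebra that quadrants generate. *)
Lemma measurable_planeE : (measurable : set (set (plane R))) =
  <<s [set A | exists x y : R, A = `]-oo, x] `*` `]-oo, y]] >>.
Proof.
set G : set (set (plane R)) := [set A | exists x y : R, A = _].
have Gfst : measurable_fun setT (fst : g_sigma_algebraType G -> measurableTypeR R).
  apply: (measurability _ (RGenOInfty.measurableE R)) => // _ [_ [x ->] <-].
  rewrite setTI [X in measurable X](_ : _ =
      ~` \bigcup_k (`]-oo, x] `*` `]-oo, k%:R])).
    apply/measurableC/bigcupT_measurable => k; apply: sub_sigma_algebra.
    by exists x, k%:R.
  apply/seteqP; split => -[s t] /=; rewrite in_itv/= andbT.
    by move=> xs [k _ [/=]]; rewrite in_itv/= leNgt xs.
  move=> st; rewrite ltNge; apply/negP => sx; apply: st.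
  exists (Num.truncn `|t|).+1 => //; split => /=; rewrite in_itv//=.
  by rewrite (le_trans (ler_norm _))// ltW// truncnS_gt.
have Gsnd : measurable_fun setT (snd : g_sigma_algebraType G -> measurableTypeR R).
  apply: (measurability _ (RGenOInfty.measurableE R)) => // _ [_ [x ->] <-].
  rewrite setTI [X in measurable X](_ : _ =
      ~` \bigcup_k (`]-oo, k%:R] `*` `]-oo, x])).
    apply/measurableC/bigcupT_measurable => k; apply: sub_sigma_algebra.
    by exists k%:R, x.
  apply/seteqP; split => -[s t] /=; rewrite in_itv/= andbT.
    by move=> xt [k _ [/= _]]; rewrite in_itv/= leNgt xt.
  move=> st; rewrite ltNge; apply/negP => tx; apply: st.
  exists (Num.truncn `|s|).+1 => //; split => /=; rewrite in_itv//=.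
  by rewrite (le_trans (ler_norm _))// ltW// truncnS_gt.
rewrite measurable_prod_measurableType; apply/seteqP; split.
  apply: smallest_sub; first exact: smallest_sigma_algebra.
  move=> _ [A mA [B mB <-]].
  have -> : A `*` B = (setT `&` fst @^-1` A) `&` (setT `&` snd @^-1` B).
    by rewrite !setTI; apply/seteqP; split => -[].
  exact: (measurableI _ _ (Gfst measurableT _ mA) (Gsnd measurableT _ mB)).
apply: smallest_sub; first exact: smallest_sigma_algebra.
move=> _ [x [y ->]]; apply: sub_sigma_algebra.
by exists `]-oo, x]%classic => //; exists `]-oo, y]%classic.
Qed.

(** As [A 1 1 = 1], all mass lies in the unit square, so the mass of any quadrant is determined by
    [A]. Quadrants are stable under intersection, generate the sigma-algebra and exhaust the
    plane. *)
Lemma copula_measure_unique (A : R -> R -> R) (mu nu : probability (plane R) R) :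
  A 1 1 = 1 -> is_copula_measure A mu -> is_copula_measure A nu ->
  forall E, measurable E -> mu E = nu E.
Proof.
move=> A11 muA nuA.
pose quadrant (x y : R) : set (plane R) := `]-oo, x] `*` `]-oo, y].
have mq x y : measurable (quadrant x y) by exact: measurableX.
have mII : measurable (I `*` I : set (plane R)).
  by apply: measurableX; exact: measurable_unit_itv.
have restrict (m : probability (plane R) R) : is_copula_measure A m ->
    forall E, measurable E -> m E = m (E `&` (I `*` I)).
  move=> mA E mE; apply: (@eq_measure_off_null _ _ _ m _ _ (~` (I `*` I))) => //.
  - exact: measurableI.
  - exact: measurableC.
  - transitivity (1 - m (I `*` I))%E; first exact: probability_setC.
    have -> : m (I `*` I) = (A 1 1)%:E by apply: mA; rewrite ler01 lexx.
    by rewrite A11 subee.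
  - by rewrite !setDE setCK -setIA setIid.
have quadrantE (m : probability (plane R) R) : is_copula_measure A m ->
    forall x y, m (quadrant x y) =
      if (0 <= x) && (0 <= y) then (A (Num.min x 1) (Num.min y 1))%:E else 0%E.
  move=> mA x y; rewrite (restrict _ mA)//; case: ifPn => [/andP[x0 y0]|xy].
    rewrite -mA ?le_min ?ge_min ?x0 ?y0 ?ler01 ?lexx ?orbT//.
    congr (m _); apply/seteqP; split => -[s t] /=;
      rewrite /quadrant /unit_itv /= !in_itv/= ?le_min.
      by move=> [[sx ty] [/andP[s0 s1] /andP[t0 t1]]]; rewrite s0 t0 sx ty s1.
    by move=> [/and3P[-> -> ->] /and3P[-> -> ->]].
  rewrite (_ : _ `&` _ = set0) ?measure0//.
  apply/seteqP; split => // -[s t] /=; rewrite /quadrant /unit_itv /= !in_itv/=.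
  move=> [[sx ty] [/andP[s0 _] /andP[t0 _]]].
  by move/negP : xy; apply; rewrite (le_trans s0 sx) (le_trans t0 ty).
apply: (@measure_unique _ _ _ [set E | exists x y : R, E = quadrant x y]
  (fun k => quadrant k%:R k%:R)).
- exact: measurable_planeE.
- move=> _ _ [x [y ->]] [x' [y' ->]]; exists (Num.min x x'), (Num.min y y').
  apply/seteqP; split => -[s t]; rewrite /quadrant /unit_itv /= !in_itv/= !le_min.
    by move=> [[-> ->] [-> ->]].
  by move=> [/andP[-> ->] /andP[-> ->]].
- by move=> k; exists k%:R, k%:R.
- apply/seteqP; split => // -[s t] _.
  exists (Num.truncn (Num.max `|s| `|t|)).+1 => //.
  have /ltW := truncnS_gt (Num.max `|s| `|t|); rewrite ge_max => /andP[sk tk].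
  by split => /=; rewrite in_itv/= (le_trans (ler_norm _)).
- move=> _ [x [y ->]].
  exact: (etrans (quadrantE _ muA x y) (esym (quadrantE _ nuA x y))).
- by move=> k; rewrite (le_lt_trans (probability_le1 _ _)) ?ltry//; exact: mq.
Qed.

End copula_measures.

(** * Kendall's tau as an integral along the graph *)

Section kendall_tau_cd_copula.
Context {R : realType}.
Local Notation I := (unit_itv R).
Local Notation leb := (@lebesgue_measure R).

Lemma integral_unit_uniform (u : measurableTypeR R -> \bar R) :
  measurable_fun setT u -> (forall t, 0 <= u t)%E ->
  (\int[uniform_prob (@ltr01 R)]_t u t = \int[leb]_(t in I) u t)%E.
Proof. by move=> mu u0; rewrite integral_uniform// subr0 invr1 mul1e. Qed.

Lemma unit_uniformE (E : set (measurableTypeR R)) : measurable E ->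
  uniform_prob (@ltr01 R) E = leb (E `&` I).
Proof.
move=> mE; have mI := @measurable_unit_itv R.
transitivity (\int[uniform_prob (@ltr01 R)]_t (\1_E t)%:E)%E.
  by rewrite integral_indic// setIT.
rewrite integral_unit_uniform; first by rewrite integral_indic.
- by apply/measurable_EFinP.
- by move=> t; rewrite lee_fin.
Qed.

(** For [X] uniform on the unit interval, the law of [(X, f X)] is a measure of this copula. By
    uniqueness it agrees with the selected one, and a change of variables moves the integral to the
    line. *)
Lemma kendall_tau_cd_copula (f : R -> R) :
  measurable_fun setT f -> set_fun I I f ->
  kendall_tau (cd_copula f) =
    4 * fine (\int[leb]_(t in I) (cd_copula f t (f t))%:E)%E - 1.
Proof.
move=> mf fI; have mI := @measurable_unit_itv R.
have A0 x y : 0 <= cd_copula f x y by rewrite fine_ge0.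
have mA : measurable_fun (setT : set (plane R)) (fun z => (cd_copula f z.1 z.2)%:E).
  by apply/measurable_EFinP; exact: measurable_cd_copula.
have A11 : cd_copula f 1 1 = 1.
  apply: EFin_inj; rewrite cd_copulaE// -(@lebesgue_unit_itv R); congr (leb _).
  apply/seteqP; split => [t []//|t It]; split => //.
  have := fI t It; move: It; rewrite /unit_itv /= !in_itv/=.
  by move=> /andP[_ ->] /andP[_ ->].
pose phi : measurableTypeR R -> plane R := fun t => (t, f t).
have mX : measurable_fun setT phi.
  exact: measurable_fun_pair.
pose X : {mfun measurableTypeR R >-> plane R} :=
  @mfun_Sub _ _ (measurableTypeR R) (plane R) phi (mem_set mX).
pose nu : probability (plane R) R := distribution (uniform_prob (@ltr01 R)) X.
have nuA : is_copula_measure (cd_copula f) nu.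
  move=> x y /andP[x0 x1] /andP[y0 y1].
  transitivity (uniform_prob (@ltr01 R) (X @^-1` (`[0, x] `*` `[0, y]))) => //.
  rewrite unit_uniformE; last first.
    by rewrite -[E in measurable E]setTI; apply: (mX) => //; exact: measurableX.
  rewrite cd_copulaE//; congr (leb _); apply/seteqP; split => t /=.
    by rewrite !in_itv/= => -[[/andP[_ ->] /andP[_ ->]] It].
  move=> [It [tx fy]]; have := fI t It; have := It.
  rewrite /unit_itv /= !in_itv/= tx fy => /andP[t0 t1] /andP[f0 f1].
  by rewrite t0 t1 f0.
(* [get] returns a measure with the required property because [nu] witnesses that one exists. *)
have muA : is_copula_measure (cd_copula f) (copula_measure (cd_copula f)).
  by apply: getPex; exists nu.
have mII : measurable (I `*` I : set (plane R)) by exact: measurableX.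
rewrite /kendall_tau /Rintegral; congr (4 * fine _ - 1).
rewrite (@eq_measure_integral _ _ _ _ nu); last first.
  by move=> E mE _; exact: (copula_measure_unique _ _ _ A11 muA nuA).
rewrite integral_mkcond.
have mAI : measurable_fun (setT : set (plane R))
    ((fun z => (cd_copula f z.1 z.2)%:E) \_ (I `*` I)).
  apply/(measurable_restrictT _ mII); exact: measurable_funS mA.
have AI0 z : (0 <= ((fun z => (cd_copula f z.1 z.2)%:E) \_ (I `*` I)) z)%E.
  by rewrite patchE; case: ifPn => _; rewrite lee_fin.
rewrite ge0_integral_distribution// integral_unit_uniform; last 2 first.
- exact: (measurableT_comp mAI mX).
- by move=> t; exact: AI0.
apply: eq_integral => t /set_mem It /=.
by rewrite patchE mem_set//; split => //; exact: fI.
Qed.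

End kendall_tau_cd_copula.

(** * Areas of the two regions and of their intersection *)

Lemma integral_id_unit {R : realType} :
  (\int[lebesgue_measure]_(x in unit_itv R) x%:E = (2^-1)%:E)%E.
Proof.
pose F : R -> R := 2^-1 *: (fun x => x ^+ 2).
have dF (x : R) : is_derive x 1 F x.
  have dX := @exprn_derivable R 2 x 1.
  apply: DeriveDef; first exact: derivableZ.
  rewrite deriveZ// exp_derive expr1 /GRing.scale /= mulr1 mulrA mulVf ?mul1r//.
have cF : continuous F.
  move=> x; apply: differentiable_continuous; apply/derivable1_diffP.
  exact: (@ex_derive _ _ _ _ _ _ _ (dF x)).
rewrite (@continuous_FTC2 _ id F 0 1) ?ltr01//.
- rewrite /F /GRing.scale /= expr1n expr0n/= scaler0 -EFinB subr0.
  by rewrite -[_%:A]/(_ * 1) mulr1.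
- by apply: continuous_subspaceT => x; exact: cvg_id.
- split; [by move=> x _; exact: (@ex_derive _ _ _ _ _ _ _ (dF x))|..].
  + exact: cvg_at_right_filter (cF 0).
  + exact: cvg_at_left_filter (cF 1).
- by move=> x _; rewrite derive1E; exact: (@derive_val _ _ _ _ _ _ _ (dF x)).
Qed.

(** [lebesgue2] integrates vertical sections by definition; uniqueness of the product measure
    permits horizontal ones. *)
Lemma lebesgue2_ysection {R : realType} (E : set (plane R)) : measurable E ->
  (@lebesgue2 R E =
   \int[@lebesgue_measure R]_y lebesgue_measure (ysection E y))%E.
Proof.
move=> mE; rewrite /lebesgue2.
transitivity ((lebesgue_measure \x^ lebesgue_measure)%E E) => //.
apply: (@product_measure_unique _ _ _ _ _ lebesgue_measure lebesgue_measure
  (lebesgue_measure \x^ lebesgue_measure)%E) => //.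
by move=> A B mA mB; rewrite [LHS]product_measure2E.
Qed.

Section areas.
Context {R : realType} (f g : R -> R).
Local Notation I := (unit_itv R).
Local Notation leb := (@lebesgue_measure R).

Hypothesis mf : measurable_fun setT f.
Hypothesis mg : measurable_fun setT g.
Hypothesis fI : set_fun I I f.
Hypothesis gf : forall x y, cd_copula g y x = cd_copula f x y.

Lemma cd_copula_x1 (x : R) : I x -> cd_copula f x 1 = x.
Proof.
move=> /[dup] Ix; rewrite /unit_itv /= in_itv/= => /andP[x0 x1].
apply: EFin_inj; rewrite cd_copulaE//.
transitivity (leb `[0, x]).
  congr (leb _); apply/seteqP; split => t /=; rewrite in_itv/=.
    by move=> [+ [tx _]]; rewrite /unit_itv /= in_itv/= => /andP[-> _].
  move=> /andP[t0 tx]; have It : I t by rewrite /unit_itv /= in_itv/= t0 (le_trans tx).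
  split => //; split => //; have := fI t It.
  by rewrite /unit_itv /= in_itv/= => /andP[].
rewrite lebesgue_measure_itv/= lte_fin; case: ltgtP x0 => // [_ _|<- _//].
by rewrite oppr0 adde0.
Qed.

Hypothesis fU : forall y, I y -> cd_copula f 1 y = y.

(** The horizontal section at height [y] has measure [cd_copula f 1 y], which is [y]. *)
Lemma lebesgue2_region :
  @lebesgue2 R (cd_region f `&` (I `*` I)) = (2^-1)%:E.
Proof.
have mI := @measurable_unit_itv R.
rewrite lebesgue2_ysection; last first.
  by apply: measurableI; [exact: measurable_cd_region|exact: measurableX].
rewrite -integral_id_unit [RHS]integral_mkcond; apply: eq_integral => y _.
rewrite patchE; case: ifPn => [/set_mem Iy|/negP nIy].
  rewrite -[in RHS](fU _ Iy) cd_copulaE//; congr (leb _).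
  apply/seteqP; split => x; rewrite /ysection /= inE /=.
    move=> [[Ix fxy] _]; split => //; split => //.
    by move: Ix; rewrite /unit_itv /= in_itv/= => /andP[].
  by move=> [Ix [_ fxy]].
rewrite (_ : ysection _ y = set0) ?measure0//.
apply/seteqP; split => // x; rewrite /ysection /= inE /= => -[_ [_ Iy]].
by apply: nIy; rewrite inE.
Qed.

(** The vertical section at [x] has measure [cd_copula g 1 x], which equals [cd_copula f x 1] and
    hence [x]. *)
Lemma lebesgue2_region_swap :
  @lebesgue2 R (cd_region_swap g `&` (I `*` I)) = (2^-1)%:E.
Proof.
rewrite -integral_id_unit [RHS]integral_mkcond; apply: eq_integral => x _ /=.
rewrite patchE; case: ifPn => [/set_mem Ix|/negP nIx].
  rewrite -[in RHS](cd_copula_x1 _ Ix) -gf cd_copulaE//; congr (leb _).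
  apply/seteqP; split => y; rewrite /xsection /= inE /=.
    move=> [[Iy gyx] _]; split => //; split => //.
    by move: Iy; rewrite /unit_itv /= in_itv/= => /andP[].
  by move=> [Iy [_ gyx]].
rewrite (_ : xsection _ x = set0) ?measure0//.
apply/seteqP; split => // y; rewrite /xsection /= inE /= => -[_ [Ix _]].
by apply: nIx; rewrite inE.
Qed.

(** In the column over [x], the points of the unit interval with [g y <= x] have total measure [x].
    Those with [f x <= y] form the section of the intersection, and the others have measure
    [cd_copula g (f x) x], that is [cd_copula f x (f x)]. Stating a sum avoids subtraction of
    extended reals. *)
Lemma lebesgue2_regionI :
  (@lebesgue2 R (cd_region f `&` cd_region_swap g `&` (I `*` I)) +
   \int[leb]_(x in I) (cd_copula f x (f x))%:E = (2^-1)%:E)%E.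
Proof.
have mI := @measurable_unit_itv R.
set E := _ `&` (I `*` I).
have mE : measurable E.
  apply: measurableI; last exact: measurableX.
  by apply: measurableI; [exact: measurable_cd_region|exact: measurable_cd_region_swap].
have -> : @lebesgue2 R E = (\int[leb]_(x in I) leb (xsection E x))%E.
  rewrite [RHS]integral_mkcond; apply: eq_integral => x _ /=.
  rewrite patchE; case: ifPn => // /negP nIx.
  rewrite (_ : xsection _ x = set0) ?measure0//.
  apply/seteqP; split => // y; rewrite /xsection /= inE /= => -[_ [Ix _]].
  by apply: nIx; rewrite inE.
rewrite -ge0_integralD//; last 3 first.
- by apply: measurable_funTS; exact: (measurable_fun_xsection leb mE).
- by move=> x _; rewrite lee_fin fine_ge0.
- apply/measurable_EFinP/measurable_funTS.
  apply: (@measurableT_comp _ _ _ _ _ _ (fun z : plane R => cd_copula f z.1 z.2)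
      _ (fun x : R => (x, f x) : plane R)).
    exact: measurable_cd_copula.
  exact: measurable_fun_pair.
rewrite -integral_id_unit; apply: eq_integral => x /set_mem Ix.
rewrite -[in RHS](cd_copula_x1 _ Ix) -!gf !cd_copulaE//.
have mgx : measurable [set t : measurableTypeR R | g t <= x] by exact: measurable_le_set.
(* The strict inequality makes [B] disjoint from the section; only the null set [[set f x]] is
   lost. *)
pose B := [set y : measurableTypeR R | I y /\ y < f x /\ g y <= x].
have mB : measurable B.
  apply: measurableI => //; apply: measurableI => //.
  exact: (measurable_itv `]-oo, f x[).
rewrite (@eq_measure_off_null _ _ _ leb
  [set t | I t /\ t <= f x /\ g t <= x] B [set f x]) //; last 3 first.
- exact: measurable_cd_set.
- exact: lebesgue_measure_set1.
- apply/seteqP; split => y /= [[Iy [yfx gyx]] nyfx]; split => //; split => //.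
    by split => //; rewrite lt_neqAle yfx andbT; exact/eqP.
  by split => //; exact: ltW.
have I1 y : I y -> y <= 1 by rewrite /unit_itv /= in_itv/= => /andP[].
rewrite -measureU//; last 2 first.
- exact: measurable_xsection.
- apply/seteqP; split => // y [/=]; rewrite /xsection/= inE /= => -[[[_ fxy] _] _].
  by move=> [_ [+ _]]; rewrite ltNge fxy.
congr (leb _); apply/seteqP; split => y /=; rewrite /xsection /= inE /=.
  move=> [[[[_ fxy] [Iy gyx]] _]|[Iy [yfx gyx]]]; split => //; split => //; exact: I1.
move=> [Iy [_ gyx]]; have [fxy|yfx] := leP (f x) y; [left|by right].
by split => //; split.
Qed.

End areas.

(** * The surface integral in terms of indicators *)

Lemma ge0_integral_EFinD {d} {T : measurableType d} {R : realType}
    (mu : {measure set T -> \bar R}) (D : set T) (u v : T -> R) :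
  measurable D -> measurable_fun D u -> measurable_fun D v ->
  (forall x, 0 <= u x) -> (forall x, 0 <= v x) ->
  (\int[mu]_(x in D) (u x + v x)%:E =
   \int[mu]_(x in D) (u x)%:E + \int[mu]_(x in D) (v x)%:E)%E.
Proof.
move=> mD mu_ mv u0 v0; rewrite -ge0_integralD//.
- by move=> x _; rewrite lee_fin.
- exact/measurable_EFinP.
- by move=> x _; rewrite lee_fin.
- exact/measurable_EFinP.
Qed.

Lemma measurable_sqrt_indic {d} {T : measurableType d} {R : realType}
    (U V : set T) : measurable U -> measurable V ->
  measurable_fun setT
    (fun z => Num.sqrt (\1_U z ^+ 2 + \1_V z ^+ 2 + 1) : R).
Proof.
move=> mU mV; apply: (measurableT_comp (continuous_measurable_fun (@sqrt_continuous R))).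
by do !apply: measurable_funD => //; apply: measurable_funX; exact: measurable_indic.
Qed.

(** By transposition, dA/dy at [(x, y)] is the first partial derivative of [cd_copula g] at
    [(y, x)], so one differentiation result serves both variables. *)
Lemma surf_cd_copula {R : realType} (f g : R -> R) :
  measurable_fun setT f -> measurable_fun setT g ->
  (forall x y, cd_copula g y x = cd_copula f x y) ->
  surf (cd_copula f) =
    (\int[@lebesgue2 R]_(z in unit_itv R `*` unit_itv R)
      (Num.sqrt (\1_(cd_region f) z ^+ 2 + \1_(cd_region_swap g) z ^+ 2 + 1))%:E)%E.
Proof.
move=> mf mg gf.
have [N [mN N0 HN]] := partial_x_cd_copula f mf.
have [M [mM M0 HM]] := partial_x_cd_copula g mg.
(* The vertical sections of the reflected set [M'] are the horizontal sections of [M], hence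
   null. *)
pose M' : set (plane R) := [set z | M (z.2, z.1)].
have mM' : measurable M'.
  have mswap : measurable_fun setT (fun z : plane R => (z.2, z.1) : plane R).
    by apply: measurable_fun_pair; [exact: measurable_snd|exact: measurable_fst].
  by rewrite -[X in measurable X]setTI; exact: mswap.
have mS : measurable (unit_itv R `*` unit_itv R : set (plane R)).
  by apply: measurableX; exact: measurable_unit_itv.
have N20 : @lebesgue2 R N = 0%E.
  by rewrite lebesgue2_ysection//; apply: integral0_eq => y _; exact: N0.
have M20 : @lebesgue2 R M' = 0%E.
  by apply: integral0_eq => x _ /=; rewrite -[RHS](M0 x).
have NM0 : @lebesgue2 R (N `|` M') = 0%E.
  by rewrite -N20; exact: measureU0.
apply: (@ge0_integral_off_null _ _ _ _ _ (N `|` M')) => //.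
- exact: measurableU.
- apply/measurable_EFinP/measurable_funTS; apply: measurable_sqrt_indic.
    exact: measurable_cd_region.
  exact: measurable_cd_region_swap.
move=> [x y] _ /not_orP[/HN Nxy /= Mxy].
rewrite Nxy; congr ((Num.sqrt (_ + _ ^+ 2 + 1))%:E).
rewrite /partial_y; under eq_fun do rewrite -gf.
exact: HM.
Qed.

(** The root takes the values 1, [Num.sqrt 2] and [Num.sqrt 3] according to how many indicators are
    1. The term in [a && b] stands on the left so that every coefficient is nonnegative. *)
Lemma sqrt_indicE {R : realType} (a b : bool) :
  Num.sqrt (a%:R ^+ 2 + b%:R ^+ 2 + 1) +
    (2 * Num.sqrt 2 - 1 - Num.sqrt 3) * (a && b)%:R =
  1 + (Num.sqrt 2 - 1) * a%:R + (Num.sqrt 2 - 1) * b%:R :> R.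
Proof.
have e2 : 1 + 1 = 2 :> R by [].
have e3 : 2 + 1 = 3 :> R by rewrite -(natrD _ 2 1).
case: a b => -[] /=; rewrite ?expr1n ?expr0n /= ?addr0 ?add0r ?e2 ?e3 ?sqrtr1; lra.
Qed.

Lemma sqrt_coef_ge0 {R : realType} : 0 <= 2 * Num.sqrt 2 - 1 - Num.sqrt 3 :> R.
Proof.
have s2 : Num.sqrt 2 ^+ 2 = 2 :> R by rewrite sqr_sqrtr.
have s3 : Num.sqrt 3 ^+ 2 = 3 :> R by rewrite sqr_sqrtr.
have a0 := sqrtr_ge0 (2 : R); have b0 := sqrtr_ge0 (3 : R).
(* The two rational bounds fit exactly: twice 7/5 is 1 + 9/5. *)
have a1 : 7 / 5 <= Num.sqrt 2 :> R by rewrite leNgt; apply/negP => ?; nra.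
have b1 : Num.sqrt 3 <= 9 / 5 :> R by rewrite leNgt; apply/negP => ?; nra.
lra.
Qed.

Theorem theorem3p5 (R : realType) (h : R -> R)
    (hh : mutually_completely_dependent h) :
  surf (cd_copula h) =
    (Num.sqrt 2 - (2 * Num.sqrt 2 - 1 - Num.sqrt 3) / 4
                  * (1 - kendall_tau (cd_copula h)))%:E.
Proof.
have [hpres [_ hinj _]] := hh; have [hI mh hE] := hpres.
have mI := @measurable_unit_itv R.
have mS : measurable (unit_itv R `*` unit_itv R : set (plane R)) by exact: measurableX.
have [g [B [mg mB BI B0 gh]]] : exists g : R -> R, exists B : set R,
    [/\ measurable_fun setT g, measurable B, B `<=` unit_itv R,
        lebesgue_measure (unit_itv R `\` B) = 0%E
      & forall t, B t -> g (h t) = t].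
  by apply: measurable_inverse_off_null => //; rewrite lebesgue_unit_itv ltry.
rewrite -(cd_copula_restrict h); set f := h \_ (unit_itv R).
have mf : measurable_fun setT f by apply/(measurable_restrictT h mI).
have fI : set_fun (unit_itv R) (unit_itv R) f.
  by move=> t It; rewrite /f patchE mem_set//; exact: hI.
have gf x y : cd_copula g y x = cd_copula f x y.
  by rewrite /f cd_copula_restrict; exact: (cd_copula_swap h g B).
(* The second margin is uniform because [h] preserves the measure of [[0, y]]. *)
have fU y : unit_itv R y -> cd_copula f 1 y = y.
  rewrite /unit_itv /= in_itv/= => /andP[y0 y1].
  apply: EFin_inj; rewrite cd_copulaE//.
  transitivity (@lebesgue_measure R `[0, y]).
    rewrite -(hE `[0, y]%classic); last 2 first.
    - exact: measurable_itv.
    - by apply: subset_itvl; rewrite bnd_simp.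
    congr (lebesgue_measure _); apply/seteqP; split => t /=.
      move=> [It [_ fy]]; split => //; have := hI t It.
      rewrite /unit_itv /= !in_itv/= => /andP[-> _].
      by move: fy; rewrite /f patchE mem_set.
    rewrite in_itv/= => -[It /andP[_ hy]]; split => //; split; last first.
      by rewrite /f patchE mem_set.
    by move: It; rewrite /unit_itv /= in_itv/= => /andP[].
  rewrite lebesgue_measure_itv/= lte_fin; case: ltgtP y0 => // [_ _|<- _//].
  by rewrite oppr0 adde0.
rewrite (surf_cd_copula f g mf mg gf) kendall_tau_cd_copula//.
have A1 := lebesgue2_region f mf fU.
have A2 := lebesgue2_region_swap f g mf mg fI gf.
have A3 := lebesgue2_regionI f g mf mg fI gf.
set k : R := 2 * Num.sqrt 2 - 1 - Num.sqrt 3.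
have k0 : 0 <= k by exact: sqrt_coef_ge0.
have l0 : 0 <= Num.sqrt 2 - 1 :> R.
  by rewrite subr_ge0 -[X in X <= _]sqrtr1 ler_wsqrtr// ler1n.
set U := cd_region f in A1 A3 *; set V := cd_region_swap g in A2 A3 *.
set S := unit_itv R `*` unit_itv R in A1 A2 A3 *.
have mU : measurable U by exact: measurable_cd_region.
have mV : measurable V by exact: measurable_cd_region_swap.
pose phi (z : plane R) : R := Num.sqrt (\1_U z ^+ 2 + \1_V z ^+ 2 + 1).
rewrite -[LHS]/(\int[@lebesgue2 R]_(z in S) (phi z)%:E)%E.
have mphi : measurable_fun setT phi by exact: measurable_sqrt_indic.
have intk (c : R) (E : set (plane R)) : 0 <= c -> measurable E ->
    (\int[@lebesgue2 R]_(z in S) (c * \1_E z)%:E = c%:E * @lebesgue2 R (E `&` S))%E.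
  move=> c0 mE; under eq_integral do rewrite EFinM.
  rewrite ge0_integralZl//; first by rewrite integral_indic.
  by apply/measurable_EFinP/measurable_funTS/measurable_indic.
(* The pointwise identity [sqrt_indicE] is integrated over the square; the constant 1 is written
   with the indicator of [setT] so that [intk] evaluates it too. *)
have : (\int[@lebesgue2 R]_(z in S) (phi z)%:E +
    \int[@lebesgue2 R]_(z in S) (k * \1_(U `&` V) z)%:E =
    \int[@lebesgue2 R]_(z in S) (1 * \1_(setT : set (plane R)) z)%:E +
    \int[@lebesgue2 R]_(z in S) ((Num.sqrt 2 - 1) * \1_U z)%:E +
    \int[@lebesgue2 R]_(z in S) ((Num.sqrt 2 - 1) * \1_V z)%:E)%E.
  have mc (c : R) (E : set (plane R)) : measurable E ->
      measurable_fun S (fun z => c * \1_E z).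
    move=> mE; apply: measurable_funTS.
    by apply: measurable_funM; [exact: measurable_cst|exact: measurable_indic].
  have c0 (c : R) (E : set (plane R)) (z : plane R) : 0 <= c -> 0 <= c * \1_E z.
    by move=> c0; rewrite mulr_ge0.
  have mUV : measurable (U `&` V) by exact: measurableI.
  pose w (c : R) (E : set (plane R)) (z : plane R) : R := c * \1_E z.
  transitivity (\int[@lebesgue2 R]_(z in S) (phi z + w k (U `&` V) z)%:E)%E.
    apply/esym/ge0_integral_EFinD => //.
    - exact: measurable_funTS.
    - exact: mc.
    - by move=> z; exact: sqrtr_ge0.
    - by move=> z; exact: c0.
  transitivity (\int[@lebesgue2 R]_(z in S)
      (w 1 setT z + w (Num.sqrt 2 - 1) U z + w (Num.sqrt 2 - 1) V z)%:E)%E.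
    apply: eq_integral => z _; congr EFin.
    rewrite /phi /w !indicE in_setI in_setT mulr1; exact: sqrt_indicE.
  transitivity (\int[@lebesgue2 R]_(z in S)
      (w 1 setT z + w (Num.sqrt 2 - 1) U z)%:E +
    \int[@lebesgue2 R]_(z in S) (w (Num.sqrt 2 - 1) V z)%:E)%E.
    apply: ge0_integral_EFinD => //.
    - by apply: measurable_funD; exact: mc.
    - exact: mc.
    - by move=> z; rewrite addr_ge0// c0.
    - by move=> z; exact: c0.
  congr (_ + _)%E; apply: ge0_integral_EFinD => //.
  - exact: mc.
  - exact: mc.
  - by move=> z; exact: c0.
  - by move=> z; exact: c0.
rewrite !intk//; last exact: measurableI.
rewrite A1 A2 setTI.
have -> : @lebesgue2 R S = 1%E.
  transitivity (@lebesgue_measure R (unit_itv R) *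
    @lebesgue_measure R (unit_itv R))%E; first exact: product_measure1E.
  by rewrite lebesgue_unit_itv mule1.
have S0 : (0 <= @lebesgue2 R (U `&` V `&` S))%E by exact: measure_ge0.
have T0 : (0 <= \int[@lebesgue_measure R]_(x in unit_itv R) (cd_copula f x (f x))%:E)%E.
  by apply: integral_ge0 => x _; rewrite lee_fin fine_ge0.
(* Nonnegative [a] and [t] with sum 1/2 are finite, and then so is the surface area [s]. As tau is
   [4 * t - 1], the quantity [(1 - tau) / 4] equals [1/2 - t], which is [a]. *)
move: A3 S0 T0.
move: (@lebesgue2 R (U `&` V `&` S))
  (\int[@lebesgue_measure R]_(x in unit_itv R) (cd_copula f x (f x))%:E)%E => a t.
move: (\int[@lebesgue2 R]_(x in S) (phi x)%:E)%E => s.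
case: a => [a| |//]; case: t => [t| |//]; rewrite ?lee_fin// => -[at2] _ _.
case: s => [s| |] //=; rewrite -?EFinM -?EFinD => -[] // sE.
congr EFin; nra.
Qed.
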